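(* Let $G$ be an ordered group with identity $e$ and let $K\le G$ be a subgroup that is prime as an ordered set (with the induced order), with $|K|\ge 3$. Then there is a unique $H\in\mathcal V(G)$ such that $$K\le H,\qquad K\cap H^-=\{e\},$$ and the natural map $K\to Q_H=H/H^-$, $k\mapsto kH^-$, is an embedding of ordered groups. Moreover $Q_H$ is prime, and $S_G(e,k)=H$ for every $k\in K\setminus\{e\}$.
   Context: An ordered group is a group $G$ (identity $e$) equipped with a partial order $\le$ such that $x\le y$ implies $axb\le ayb$ for all $a,b,x,y\in G$. A module of a poset $X$ is a subset $M$ such that for every $x\in X\setminus M$ and $m,m'\in M$: $x\le m\iff x\le m'$ and $m\le x\iff m'\le x$. The empty set, singletons and $X$ are trivial modules; the poset is prime if it has no other module. A nonempty module $M$ is strong if every module is disjoint from $M$, contained in $M$, or contains $M$. $S_G(x,y)$ is the least strong module of the poset $G$ containing $x$ and $y$; $\mathcal V(G):=\{S_G(e,g):g\ne e\}$, and $H^-:=\{e\}\cup\bigcup\{L\in\mathcal V(G):L\subsetneq H\}$ for $H\in\mathcal V(G)$. It is known that $\mathcal V(G)$ is a chain under inclusion of convex subgroups and that $H^-$ is a proper convex normal subgroup of $H$; $Q_H=H/H^-$ is the ordered group with order $\alpha\le\beta$ iff $a\le b$ for some $a\in\alpha$, $b\in\beta$. An embedding of ordered groups is an injective homomorphism that preserves and reflects the order. *)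

(* Defs.v *)
From HB Require Import structures.
From mathcomp Require Import all_boot all_order.
From mathcomp Require Import boolp classical_sets functions cardinality.

Set Implicit Arguments.
Unset Strict Implicit.
Unset Printing Implicit Defensive.

Import Order.TTheory.

Local Open Scope classical_set_scope.
Local Open Scope order_scope.
Local Open Scope group_scope.

HB.mixin Record isOrderedGroup d G of Group G & Order.POrder d G := {
  le_mulg2 : forall a b x y : G, x <= y -> a * x * b <= a * y * b
}.

#[short(type="ogroupType")]
HB.structure Definition OrderedGroup d :=
  {G of Group G & Order.POrder d G & isOrderedGroup d G}.

Definition ogroup_embedding d (A : ogroupType d) d' (B : ogroupType d')
    (f : A -> B) : Prop :=
  [/\ injective f, {morph f : x y / x * y} & {mono f : x y / x <= y}].

Definition subgroup_type (G : groupType) (K : groupClosed G) : Type :=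
  {x : G | x \in K}.

Section SubgroupType.
Context d (G : ogroupType d) (K : groupClosed G).

Fact subgroup_closed : group_closed K.
Proof. by split; [exact: gpred1|exact: gpredF]. Qed.

HB.instance Definition _ := SubChoice.on (subgroup_type K).
HB.instance Definition _ := SubChoice_isSubGroup.Build G (mem K)
  (subgroup_type K) subgroup_closed.
HB.instance Definition _ := Order.SubChoice_isSubPOrder.Build d G (mem K) d
  (subgroup_type K).

Fact subgroup_le_mulg2 (a b x y : subgroup_type K) :
  x <= y -> a * x * b <= a * y * b.
Proof. exact: (@le_mulg2 d G). Qed.

HB.instance Definition _ :=
  isOrderedGroup.Build d (subgroup_type K) subgroup_le_mulg2.

End SubgroupType.

Section Modules.
Context d (X : porderType d).

Definition is_module (M : set X) : Prop :=
  forall x m m', ~ M x -> M m -> M m' ->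
    (x <= m <-> x <= m') /\ (m <= x <-> m' <= x).

Definition prime_poset : Prop :=
  forall M : set X, is_module M ->
    [\/ M = set0, exists x, M = [set x] | M = setT].

Definition strong_module (M : set X) : Prop :=
  [/\ M !=set0, is_module M & forall N, is_module N ->
      [\/ N `&` M = set0, N `<=` M | M `<=` N]].

(* The intersection of all strong modules containing [x] and [y];
   [strong_smod] below shows that it is itself a strong module. *)
Definition smod (x y : X) : set X := smallest strong_module [set x; y].

Lemma smodP x y z :
  smod x y z <-> forall M, strong_module M -> M x -> M y -> M z.
Proof.
split=> [h M sM Mx My|h M [sM sub]].
  by apply: h; split=> // _ [->|->].
by apply: h => //; apply: sub; [left|right].
Qed.

Lemma smodl x y : smod x y x. Proof. by apply/smodP. Qed.
Lemma smodr x y : smod x y y. Proof. by apply/smodP. Qed.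

Lemma smod_least x y M : strong_module M -> M x -> M y -> smod x y `<=` M.
Proof. by move=> sM Mx My z /smodP; exact. Qed.

Lemma strong_smod x y : strong_module (smod x y).
Proof.
split; first by exists x; exact: smodl.
  move=> z m m' nz /smodP Sm /smodP Sm'.
  have [M [sM Mx My nMz]] :
      exists M, [/\ strong_module M, M x, M y & ~ M z].
    apply: contrapT => /forallNP h; apply: nz; apply/smodP => M sM Mx My.
    by apply: contrapT => nMz; apply: (h M).
  case: (sM) => _ modM _.
  exact: (modM _ _ _ nMz (Sm _ sM Mx My) (Sm' _ sM Mx My)).
move=> N modN; apply: contrapT => h.
have h1 : N `&` smod x y <> set0 by move=> ?; apply: h; apply: Or31.
have h2 : ~ N `<=` smod x y by move=> ?; apply: h; apply: Or32.
have h3 : ~ smod x y `<=` N by move=> ?; apply: h; apply: Or33.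
have [z [Nz Sz]] : exists z, N z /\ smod x y z.
  by apply: contrapT => /forallNP h'; apply: h1; apply/seteqP; split.
apply: h2 => t Nt; apply/smodP => M sM Mx My; case: (sM) => _ _ /(_ _ modN).
have subM := smod_least sM Mx My.
case=> [e|NM|MN]; last by case: h3 => u /subM /MN.
  have : (N `&` M) z by exact: (conj Nz (subM _ Sz)).
  by rewrite e.
exact: NM.
Qed.

Lemma smod_sub x y u v : smod x y u -> smod x y v -> smod u v `<=` smod x y.
Proof. by apply: smod_least; exact: strong_smod. Qed.

Lemma smod_total x y u v z : smod x y z -> smod u v z ->
  smod x y `<=` smod u v \/ smod u v `<=` smod x y.
Proof.
move=> xyz uvz; have [_ modx _] := strong_smod x y.
have [_ _ /(_ _ modx)[e|h|h]] := strong_smod u v; [|by left|by right].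
by have : (smod x y `&` smod u v) z by []; rewrite e.
Qed.

Lemma module_convex (M : set X) x y z :
  is_module M -> M x -> M z -> x <= y -> y <= z -> M y.
Proof.
move=> modM Mx Mz xy yz; apply: contrapT => nMy.
have [[_ /(_ yz) yx] _] := modM _ _ _ nMy Mx Mz.
by apply: nMy; rewrite (le_anti (introT andP (conj yx xy))).
Qed.

Lemma smod_bij (f g : X -> X) : cancel f g -> cancel g f ->
  (forall M, is_module M -> is_module (f @^-1` M)) ->
  (forall M, is_module M -> is_module (g @^-1` M)) ->
  forall x y z, smod x y z -> smod (f x) (f y) (f z).
Proof.
move=> fK gK hf hg x y z /smodP h; apply/smodP => M [[w Mw] modM sM] Mx My.
apply: (h (f @^-1` M)) => //; split; first by exists (g w); rewrite /= gK.
  exact: hf.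
move=> N modN; have [e|s|s] := sM _ (hg _ modN).
- apply: Or31; apply/seteqP; split=> // t [Nt Mft].
  have : (g @^-1` N `&` M) (f t) by split=> //=; rewrite fK.
  by rewrite e.
- by apply: Or32 => t Nt; apply: s; rewrite /= fK.
- by apply: Or33 => t /= /s; rewrite /= fK.
Qed.

End Modules.

Arguments smodl {d X} x y.
Arguments smodr {d X} x y.

(* The elements of [valuation G] are shown to be convex subgroups forming a
   chain, and [hminus H] to be a convex normal subgroup of [H]; this is what
   the ordered group structure on [quot H] below rests on. *)
Section Valuation.
Context d (G : ogroupType d).
Implicit Types (a b g x y z : G).

Definition valuation : set (set G) := [set smod 1 g | g in [set~ 1]].

Definition hminus (H : set G) : set G :=
  1 |` \bigcup_(L in [set L | valuation L /\ L `<` H]) L.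

Lemma le_mul2g a b x y : (a * x * b <= a * y * b) = (x <= y).
Proof.
apply/idP/idP; last exact: le_mulg2.
move=> /(le_mulg2 a^-1 b^-1).
by rewrite !mulgA !mulVg !mul1g -!mulgA !mulgV !mulg1.
Qed.

Lemma le_invg x y : (x^-1 <= y^-1) = (y <= x).
Proof.
by rewrite -(le_mul2g x y x^-1 y^-1) mulgV mul1g -mulgA mulVg mulg1.
Qed.

Lemma module_mul a b (M : set G) :
  is_module M -> is_module ((fun x => a * x * b) @^-1` M).
Proof.
move=> modM x m m' /= nx hm hm'.
by have := modM _ _ _ nx hm hm'; rewrite !le_mul2g.
Qed.

Lemma module_inv (M : set G) : is_module M -> is_module ((fun x : G => x^-1) @^-1` M).
Proof.
move=> modM x m m' /= nx hm hm'.
by have := modM _ _ _ nx hm hm'; rewrite !le_invg => -[].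
Qed.

Lemma smod_mul a b x y z :
  smod x y z -> smod (a * x * b) (a * y * b) (a * z * b).
Proof.
apply: (@smod_bij _ _ (fun x => a * x * b) (fun x => a^-1 * x * b^-1)).
- by move=> t; rewrite !mulgA mulVg mul1g mulgK.
- by move=> t; rewrite !mulgA mulgV mul1g mulgVK.
- exact: module_mul.
- exact: module_mul.
Qed.

Lemma smod_mull a x y z : smod x y z -> smod (a * x) (a * y) (a * z).
Proof. by move=> /(@smod_mul a 1 _ _ _); rewrite !mulg1. Qed.

Lemma smod_inv x y z : smod x y z -> smod x^-1 y^-1 z^-1.
Proof.
by apply: (@smod_bij _ G (fun x => x^-1) (fun x => x^-1)); [exact: invgK..|exact: module_inv|];
  exact: module_inv.
Qed.

Lemma smodC x y : smod x y `<=` smod y x.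
Proof. by apply: smod_sub; [exact: smodr|exact: smodl]. Qed.

Lemma smod1_invE a : smod 1 a^-1 = smod 1 a.
Proof.
have inv1 b z : smod 1 b z -> smod 1 b^-1 z^-1.
  by move=> /smod_inv; rewrite invg1.
have [h|h] := smod_total (smodl 1 a^-1) (smodl 1 a); apply/seteqP; split=> // z.
  by move=> /inv1/h/inv1; rewrite !invgK.
by move=> /inv1; rewrite invgK => /h/inv1; rewrite !invgK.
Qed.

Lemma smod1_inv a z : smod 1 a z -> smod 1 a z^-1.
Proof. by move=> /smod_inv; rewrite invg1 smod1_invE. Qed.

Lemma smod1_mull a z : smod 1 a z -> smod 1 a (a * z).
Proof.
rewrite -{1}smod1_invE => /(@smod_mull a _ _ _).
by rewrite mulg1 mulgV => /smodC.
Qed.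

Lemma smod1_mulVl a z : smod 1 a z -> smod 1 a (a^-1 * z).
Proof. by rewrite -smod1_invE => /smod1_mull. Qed.

Lemma smod1_mul_key g c : smod 1 g c -> ~ smod 1 c g ->
  (forall z, smod 1 g z -> smod 1 g (c * z)) ->
  forall z, smod 1 g z -> smod 1 g (c^-1 * z).
Proof.
move=> Sc ncg cS.
have EA z : smod 1 g z <-> smod c (c * g) (c * z).
  split=> [/(@smod_mull c _ _ _)|/(@smod_mull c^-1 _ _ _)]; first by rewrite mulg1.
  by rewrite mulVg !mulKg.
have A1 : smod c (c * g) 1.
  by rewrite -(mulgV c); apply: (EA _).1; exact: smod1_inv.
set U := smod 1 (c * g).
have UA : U `<=` smod c (c * g) by apply: smod_sub => //; exact: smodr.
have Uc : U c.
  have [h|h] := smod_total (smodl 1 c) (smodl 1 (c * g)).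
    by apply: h; exact: smodr.
  case: ncg; have := h _ (smodr 1 (c * g)).
  by move=> /smod1_mulVl; rewrite mulKg.
have AU : smod c (c * g) `<=` U by apply: smod_sub => //; exact: smodr.
move=> z Sz; apply: (EA _).2; rewrite mulVKg; apply: UA.
have /AU/smod1_mulVl := (EA _).1 (smod1_mull Sz).
by rewrite invgM -mulgA !mulKg.
Qed.

Lemma smod1_mul g b z : smod 1 g b -> smod 1 g z -> smod 1 g (b * z).
Proof.
move=> Sb Sz; have [bg|nbg] := pselect (smod 1 b g).
  have e : smod 1 b = smod 1 g.
    by apply/seteqP; split; apply: smod_sub => //; exact: smodl.
  by move: Sz; rewrite -e; exact: smod1_mull.
have Sb' := smod1_inv Sb.
have ES t : smod b (b * g) t <-> smod 1 g (b^-1 * t).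
  split=> [/(@smod_mull b^-1 _ _ _)|/(@smod_mull b _ _ _)]; first by rewrite mulVg !mulKg.
  by rewrite mulg1 mulVKg.
have [h|h] := smod_total Sb (smodl b (b * g)).
  rewrite -(invgK b); apply: smod1_mul_key => //.
    by rewrite smod1_invE.
  by move=> t /h/(ES _).1.
by apply: h; apply: (ES _).2; rewrite mulKg.
Qed.

Lemma smod_conj a x y : smod 1 x y -> smod 1 (x ^ a) (y ^ a).
Proof. by move=> /(@smod_mul a^-1 a _ _ _); rewrite mulg1 mulVg -!mulgA. Qed.

Section Subgroups.
Context (H : set G) (VH : valuation H).

Lemma val1g : H 1. Proof. by case: VH => g _ <-; exact: smodl. Qed.

Lemma valVg x : H x -> H x^-1.
Proof. by case: VH => g _ <-; exact: smod1_inv. Qed.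

Lemma valMg x y : H x -> H y -> H (x * y).
Proof. by case: VH => g _ <-; exact: smod1_mul. Qed.

Lemma val_convex x y z : H x -> H z -> x <= y -> y <= z -> H y.
Proof.
by case: VH => g _ <-; apply: module_convex; case: (strong_smod 1 g).
Qed.

Lemma hminus_sub : hminus H `<=` H.
Proof.
by move=> x [->|[L [_ [LH _]] Lx]]; [exact: val1g|exact: LH].
Qed.

End Subgroups.

Lemma valuation_total (H L : set G) :
  valuation H -> valuation L -> H `<=` L \/ L `<=` H.
Proof.
by case=> g _ <- [h _ <-]; apply: smod_total; exact: smodl.
Qed.

Lemma hminus1 H : hminus H 1. Proof. by left. Qed.

Lemma hminusV H x : hminus H x -> hminus H x^-1.
Proof.
move=> [->|[L [VL LH] Lx]]; first by rewrite invg1; left.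
by right; exists L => //; exact: valVg.
Qed.

Lemma hminusM H x y : hminus H x -> hminus H y -> hminus H (x * y).
Proof.
move=> [->|[L [VL LH] Lx]]; first by rewrite mul1g.
move=> [->|[L' [VL' LH'] Ly]].
  by rewrite mulg1; right; exists L.
have [h|h] := valuation_total VL VL'; right.
  by exists L' => //; apply: valMg => //; exact: h.
by exists L => //; apply: valMg => //; exact: h.
Qed.

Lemma hminus_convex1 H x y : hminus H y -> 1 <= x -> x <= y -> hminus H x.
Proof.
move=> [->|[L [VL LH] Ly]] x1 xy.
  by left; apply/le_anti/andP.
by right; exists L => //; apply: val_convex Ly x1 xy => //; exact: val1g.
Qed.

Lemma hminusJ H x h : valuation H -> H h -> hminus H x -> hminus H (x ^ h).
Proof.
move=> VH Hh [->|[L [VL [LH nLH]] Lx]]; first by left; rewrite /= conj1g.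
right; case: VL Lx LH nLH => a /= a1 <- ax aH naH.
exists (smod 1 (a ^ h)); last exact: smod_conj.
split; first by exists (a ^ h) => //= /eqP; rewrite conjg_eq1 => /eqP.
have HJ y k : H k -> H y -> H (y ^ k).
  by move=> Hk Hy; apply: valMg => //; [exact: valVg|exact: valMg].
have [g g1 Hg] := VH; split.
  rewrite -Hg; apply: smod_sub; first exact: smodl.
  by rewrite Hg; apply: HJ => //; apply: aH; exact: smodr.
move=> Ha; apply: naH => y Hy.
by have /Ha/(@smod_conj h^-1 _ _) := HJ _ _ Hh Hy; rewrite !conjgK.
Qed.

End Valuation.

Arguments valuation {d} G.

Section Quotient.
Context d (G : ogroupType d) (H : valuation G).
Implicit Types x y z h k : G.

Let HV : valuation G (val H) := set_mem (valP H).
Let N : set G := hminus (val H).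

Definition lcoset (M : set G) (h : G) : set G := [set h * n | n in M].

Definition cosets : set (set G) := [set lcoset N h | h in val H].

(* The elements of H / H^- are the cosets themselves, as subsets of [G]. *)
Definition quot : Type := cosets.

HB.instance Definition _ := SubChoice.on quot.
Implicit Types A B C : quot.

Fact coset_of_subproof h : val H h -> lcoset N h \in cosets.
Proof. by move=> Hh; apply/mem_set; exists h. Qed.

Definition coset_of h (Hh : val H h) : quot :=
  exist _ (lcoset N h) (coset_of_subproof Hh).

Lemma quotP A : exists h (Hh : val H h), A = coset_of Hh.
Proof.
have [h Hh e] := set_mem (valP A).
by exists h, Hh; apply: val_inj; rewrite /= -e.
Qed.

Lemma lcosetP h x : lcoset N h x <-> N (h^-1 * x).
Proof.
by split=> [[n Nn <-]|Nx]; [rewrite mulKg|exists (h^-1 * x); rewrite ?mulVKg].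
Qed.

Lemma lcoset_refl h : lcoset N h h.
Proof. by apply/lcosetP; rewrite mulVg; exact: hminus1. Qed.

Lemma lcoset_eq h k : N (h^-1 * k) -> lcoset N h = lcoset N k.
Proof.
move=> hk; have kh : N (k^-1 * h).
  by rewrite -(invgK h) -invgM; exact: hminusV.
apply/seteqP; split=> x /lcosetP hx; apply/lcosetP.
  by rewrite -(mulVKg h x) mulgA; exact: hminusM.
by rewrite -(mulVKg k x) mulgA; exact: hminusM.
Qed.

Lemma coset_of_eq h k (Hh : val H h) (Hk : val H k) :
  coset_of Hh = coset_of Hk <-> N (h^-1 * k).
Proof.
split=> [/(congr1 val)/= e|hk]; last by apply/val_inj/lcoset_eq.
by apply/lcosetP; rewrite e; exact: lcoset_refl.
Qed.

Let N_J h x : val H h -> N x -> N (x ^ h).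
Proof. exact: hminusJ. Qed.

Fact quot_mul_subproof A B :
  [set x * y | x in val A & y in val B] \in cosets.
Proof.
have [h [Hh ->]] := quotP A; have [k [Hk ->]] := quotP B.
apply/mem_set; exists (h * k); first exact: valMg.
apply/seteqP; split=> [x /lcosetP hx|_ [_ [m Nm <-]] [_ [n Nn <-]] <-].
  exists h; first exact: lcoset_refl.
  exists (h^-1 * x); last by rewrite mulVKg.
  by apply/lcosetP; rewrite mulgA -invgM.
apply/lcosetP; have -> : (h * k)^-1 * (h * m * (k * n)) = m ^ k * n.
  by rewrite invgM /conjg -!mulgA mulKg.
by apply: hminusM => //; exact: N_J.
Qed.

Definition quot_mul A B : quot :=
  exist _ [set x * y | x in val A & y in val B] (quot_mul_subproof A B).

Fact quot_inv_subproof A :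
  [set x^-1 | x in val A] \in cosets.
Proof.
have [h [Hh ->]] := quotP A; apply/mem_set; exists h^-1; first exact: valVg.
have Hh' : val H h^-1 by exact: valVg.
apply/seteqP; split=> [x /lcosetP|_ [_ [n Nn <-]] <-].
  rewrite invgK => Nhx; exists x^-1; last by rewrite invgK.
  apply/lcosetP; rewrite -invgM; apply: hminusV.
  by have := N_J Hh Nhx; rewrite /conjg -mulgA mulKg.
apply/lcosetP; rewrite invgK invgM.
have -> : h * (n^-1 * h^-1) = n^-1 ^ h^-1 by rewrite /conjg invgK.
by apply: N_J => //; exact: hminusV.
Qed.

Definition quot_inv A : quot :=
  exist _ [set x^-1 | x in val A] (quot_inv_subproof A).

Definition quot_one : quot := coset_of (val1g HV).

Definition quot_le A B : bool :=
  `[< exists a b, [/\ val A a, val B b & a <= b] >].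

Lemma quot_mulE h k (Hh : val H h) (Hk : val H k) :
  quot_mul (coset_of Hh) (coset_of Hk) = coset_of (valMg HV Hh Hk).
Proof.
have [l [Hl E]] := quotP (quot_mul (coset_of Hh) (coset_of Hk)); rewrite E.
apply/coset_of_eq/lcosetP; rewrite -[lcoset _ _]/(val (coset_of Hl)) -E /=.
by exists h; [exact: lcoset_refl|exists k => //; exact: lcoset_refl].
Qed.

Lemma quot_invE h (Hh : val H h) :
  quot_inv (coset_of Hh) = coset_of (valVg HV Hh).
Proof.
have [l [Hl E]] := quotP (quot_inv (coset_of Hh)); rewrite E.
apply/coset_of_eq/lcosetP; rewrite -[lcoset _ _]/(val (coset_of Hl)) -E /=.
by exists h => //; exact: lcoset_refl.
Qed.

Lemma eq_coset_of h k (Hh : val H h) (Hk : val H k) :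
  h = k -> coset_of Hh = coset_of Hk.
Proof. by move=> e; apply/coset_of_eq; rewrite e mulVg; exact: hminus1. Qed.

Fact quot_mulA : associative quot_mul.
Proof.
move=> A B C; have [h [Hh ->]] := quotP A; have [k [Hk ->]] := quotP B.
have [l [Hl ->]] := quotP C; rewrite !quot_mulE; apply: eq_coset_of.
exact: mulgA.
Qed.

Fact quot_mul1g : left_id quot_one quot_mul.
Proof.
move=> A; have [h [Hh ->]] := quotP A; rewrite !quot_mulE.
exact/eq_coset_of/mul1g.
Qed.

Fact quot_mulg1 : right_id quot_one quot_mul.
Proof.
move=> A; have [h [Hh ->]] := quotP A; rewrite !quot_mulE.
exact/eq_coset_of/mulg1.
Qed.

Fact quot_mulVg : left_inverse quot_one quot_inv quot_mul.
Proof.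
move=> A; have [h [Hh ->]] := quotP A; rewrite quot_invE !quot_mulE.
exact/eq_coset_of/mulVg.
Qed.

Fact quot_mulgV : right_inverse quot_one quot_inv quot_mul.
Proof.
move=> A; have [h [Hh ->]] := quotP A; rewrite quot_invE !quot_mulE.
exact/eq_coset_of/mulgV.
Qed.

HB.instance Definition _ := isGroup.Build quot
  quot_mulA quot_mul1g quot_mulg1 quot_mulVg quot_mulgV.

Lemma quot_leP h k (Hh : val H h) (Hk : val H k) :
  quot_le (coset_of Hh) (coset_of Hk) <-> exists2 n, N n & h <= k * n.
Proof.
split=> [/asboolP[_ [_ [[m Nm <-] [n Nn <-] mn]]]|[n Nn hkn]].
  exists (n * m^-1); first by apply: hminusM => //; exact: hminusV.
  by move: mn => /(le_mulg2 1 m^-1); rewrite !mul1g mulgK mulgA.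
apply/asboolP; exists h, (k * n); split=> //; first exact: lcoset_refl.
by exists n.
Qed.

Fact quot_le_refl : reflexive quot_le.
Proof.
move=> A; have [h [Hh ->]] := quotP A; apply/quot_leP.
by exists 1; [exact: hminus1|rewrite mulg1].
Qed.

Fact quot_le_anti : antisymmetric quot_le.
Proof.
move=> A B; have [h [Hh ->]] := quotP A; have [k [Hk ->]] := quotP B.
move=> /andP[/quot_leP[n Nn hk] /quot_leP[m Nm kh]].
apply/coset_of_eq; have : N (h^-1 * k * n).
  apply: (@hminus_convex1 _ _ _ _ (m * n)); first exact: hminusM.
    by move: hk => /(le_mulg2 h^-1 1); rewrite !mulg1 mulVg mulgA.
  by move: kh => /(le_mulg2 h^-1 n); rewrite mulKg.
by move=> /hminusM/(_ (hminusV Nn)); rewrite mulgK.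
Qed.

Fact quot_le_trans : transitive quot_le.
Proof.
move=> B A C; have [h [Hh ->]] := quotP A; have [k [Hk ->]] := quotP B.
have [l [Hl ->]] := quotP C => /quot_leP[n Nn hk] /quot_leP[m Nm kl].
apply/quot_leP; exists (m * n); first exact: hminusM.
apply: le_trans hk _.
by move: kl => /(le_mulg2 1 n); rewrite !mul1g -mulgA.
Qed.

HB.instance Definition _ := Order.Le_isPOrder.Build d quot
  quot_le_refl quot_le_anti quot_le_trans.

Fact quot_le_mulg2 A B C D : C <= D -> A * C * B <= A * D * B.
Proof.
have [h [Hh ->]] := quotP A; have [k [Hk ->]] := quotP B.
have [l [Hl ->]] := quotP C; have [m [Hm ->]] := quotP D.
move=> /quot_leP[n Nn lm]; rewrite /mul /= !quot_mulE; apply/quot_leP.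
exists (n ^ k); first exact: N_J.
move: lm => /(le_mulg2 h k).
by rewrite /conjg -!mulgA mulVKg.
Qed.

HB.instance Definition _ := isOrderedGroup.Build d quot quot_le_mulg2.

Definition nat_map (K : groupClosed G) (KH : [set` K] `<=` val H)
  (k : subgroup_type K) : quot := coset_of (KH _ (valP k)).

End Quotient.

(* Main.v *)
(* Write [H] for the common value of [smod 1 k], [k] in [K] and [k != 1]; it
   exists because a module of [G] meeting the prime poset [K] in two points
   contains [K].  Two overlapping modules [J] and [N] cut [J] into the modules
   [J `&` N] and [J `\` N], one of which contains two of three given points of
   [K]; hence the least module containing [K] is strong, so it is [H].
   Consequently the union of the modules containing [1] but not [K] meets [K]
   in [1] only, and a module overlapping it would contain [K], hence [H]: this
   union is a strong module properly contained in [H], so it lies in [H^-].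
   Thus every module of [G] with [1] in it and strictly inside [H] lies in
   [H^-], which, after a translation, is the primality of [H / H^-]. *)
Require Import Defs.
From mathcomp Require Import all_boot all_order.
From mathcomp Require Import boolp classical_sets functions cardinality.

Set Implicit Arguments.
Unset Strict Implicit.
Unset Printing Implicit Defensive.

Local Open Scope classical_set_scope.
Local Open Scope group_scope.

(** * Modules under set operations *)

Section ModuleOperations.
Context d (X : porderType d).
Implicit Types (A B M N K : set X) (x y z : X).

Lemma is_moduleI A B : is_module A -> is_module B -> is_module (A `&` B).
Proof.
move=> modA modB x m m' nx [Am Bm] [Am' Bm'].
have [Ax|nAx] := pselect (A x); last exact: modA.
by apply: modB => // Bx; apply: nx.
Qed.

(** A point [x] of [A] outside the difference lies in [B], so points off [B] compare with [x] as
    with [b]; and [b], being outside [A], does not separate points of [A]. *)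
Lemma is_moduleD A B : is_module A -> is_module B -> B `\` A !=set0 ->
  is_module (A `\` B).
Proof.
move=> modA modB [b [Bb nAb]] x m m' nx [Am nBm] [Am' nBm'].
have [Ax|nAx] := pselect (A x); last exact: modA.
have Bx : B x by apply: contrapT => nBx; apply: nx.
have [bm mb] := modB _ _ _ nBm Bx Bb; have [bm' mb'] := modB _ _ _ nBm' Bx Bb.
have [e1 e2] := modA _ _ _ nAb Am Am'.
split; [exact: iff_trans mb (iff_trans e1 (iff_sym mb'))|].
exact: iff_trans bm (iff_trans e2 (iff_sym bm')).
Qed.

Lemma is_module_bigcup (F : set (set X)) x : (forall M, F M -> is_module M) ->
  (forall M, F M -> M x) -> is_module (\bigcup_(M in F) M).
Proof.
move=> modF Fx y m m' ny [M FM Mm] [M' FM' Mm'].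
have nM : ~ M y by move=> My; apply: ny; exists M.
have nM' : ~ M' y by move=> My; apply: ny; exists M'.
have [e1 e2] := modF _ FM _ _ _ nM Mm (Fx _ FM).
have [e3 e4] := modF _ FM' _ _ _ nM' (Fx _ FM') Mm'.
by split; [exact: iff_trans e1 e3|exact: iff_trans e2 e4].
Qed.

Lemma is_moduleU A B : is_module A -> is_module B -> A `&` B !=set0 ->
  is_module (A `|` B).
Proof.
move=> modA modB [x [Ax Bx]]; rewrite -bigcup2E.
(* [bigcup2] is [set0] from index 2 on, which would miss the common point [x]. *)
have -> : \bigcup_i bigcup2 A B i = \bigcup_(M in [set A; B]) M.
  rewrite bigcup2E; apply/seteqP; split=> y.
    by move=> [Ay|By]; [exists A => //; left|exists B => //; right].
  by move=> [_ [->|->] My]; [left|right].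
by apply: (@is_module_bigcup _ x) => _ [->|->].
Qed.

(* The condition satisfied by a subset that is prime for the induced order,
   expressed with modules of the ambient poset. *)
Definition trapped K := forall M x y, is_module M -> K x -> K y -> x <> y ->
  M x -> M y -> K `<=` M.

(** * Strong modules attached to a trapped subset *)

Section Trapped.
Variables (K : set X) (a b c : X).
Hypotheses (trapK : trapped K) (Ka : K a) (Kb : K b) (Kc : K c).
Hypotheses (ab : a <> b) (ac : a <> c) (bc : b <> c).

Lemma trapped_sub_smod : K `<=` smod a b.
Proof.
have [_ modS _] := strong_smod a b.
by apply: (trapK modS Ka Kb ab); [exact: smodl|exact: smodr].
Qed.

Lemma smod_trapped_sub M : is_module M -> K `<=` M -> smod a b `<=` M.
Proof.
set J := smallest (@is_module _ X) K.
have KJ : K `<=` J by exact: sub_smallest.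
have JM N : is_module N -> K `<=` N -> J `<=` N.
  by move=> modN KN x; apply; split.
have modJ : is_module J.
  move=> x m m' nJx Jm Jm'.
  have [N [modN KN nNx]] : exists N, [/\ is_module N, K `<=` N & ~ N x].
    apply: contrapT => h; apply: nJx => N [modN KN].
    by apply: contrapT => nNx; apply: h; exists N.
  by apply: (modN) => //; exact: (JM _ modN KN).
move=> modM KM; apply: subset_trans (JM _ modM KM).
apply: smod_least; [|exact: KJ|exact: KJ]; split=> //; first by exists a; exact: KJ.
move=> N modN.
have [e|NJ] := pselect (N `&` J = set0); first exact: Or31.
have [|nNJ] := pselect (N `<=` J); first exact: Or32.
apply: Or33; apply: contrapT => nJN.
have modI := is_moduleI modJ modN.
have modD : is_module (J `\` N).
  apply: is_moduleD => //; apply: contrapT => h; apply: nNJ => x Nx.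
  by apply: contrapT => nJx; apply: h; exists x.
(* By minimality of [J], a piece containing [K] would be all of [J], so that [N] would contain [J]
   or miss it. *)
have nI : ~ K `<=` J `&` N by move=> /(JM _ modI) h; apply: nJN => x /h[].
have nD : ~ K `<=` J `\` N.
  move=> /(JM _ modD) h; apply: NJ; apply/seteqP; split=> // x [Nx /h[_]].
  by move/(_ Nx).
have KI x y : K x -> K y -> x <> y -> N x -> N y -> False.
  move=> Kx Ky xy Nx Ny; apply: nI.
  by apply: (trapK modI Kx Ky xy); split=> //; exact: KJ.
have KD x y : K x -> K y -> x <> y -> ~ N x -> ~ N y -> False.
  move=> Kx Ky xy Nx Ny; apply: nD.
  by apply: (trapK modD Kx Ky xy); split=> //; exact: KJ.
(* Two of the three points lie on the same side of [N]. *)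
have [Na|Na] := pselect (N a); have [Nb|Nb] := pselect (N b);
  have [Nc|Nc] := pselect (N c); try exact: (KI a b); try exact: (KI a c);
  try exact: (KI b c); try exact: (KD a b); try exact: (KD a c);
  exact: (KD b c).
Qed.

Lemma strong_bigcup_avoiding :
  strong_module (\bigcup_(M in [set M | [/\ is_module M, M a & ~ K `<=` M]]) M).
Proof.
set F := [set M | _]; set A := \bigcup_(M in F) M.
have modA : is_module A by apply: (@is_module_bigcup _ a) => M [].
have AS : A `<=` smod a b.
  move=> x [M [modM Ma nKM] Mx]; have [_ _ sS] := strong_smod a b.
  have [e|h|h] := sS _ modM; last 2 first.
  - exact: h.
  - by case: nKM; apply: subset_trans h; exact: trapped_sub_smod.
  by have : (set0 : set X) a by rewrite -e; split=> //; exact: smodl.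
have AK x : K x -> A x -> x = a.
  move=> Kx [M [modM Ma nKM] Mx]; apply: contrapT => xa; apply: nKM.
  exact: (trapK modM Kx Ka xa).
have F1 : F [set a].
  split=> //; first by move=> x m m' _ -> ->.
  by move=> /(_ _ Kb) e; exact: ab (esym e).
split=> //; first by exists a, [set a].
move=> N modN.
have [e|NA] := pselect (N `&` A = set0); first exact: Or31.
have [|nNA] := pselect (N `<=` A); first exact: Or32.
apply: Or33; apply: subset_trans AS _; apply: smod_trapped_sub => //.
have modU : is_module (A `|` N).
  apply: is_moduleU => //; apply: contrapT => h; apply: NA.
  by apply/seteqP; split=> // x [Nx Ax]; apply: h; exists x.
(* Otherwise the union belongs to [F], which forces [N] into [A]. *)
have KU : K `<=` A `|` N.
  apply: contrapT => nKU; apply: nNA => x Nx; exists (A `|` N); last by right.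
  by split=> //; left; exists [set a].
(* Both points differ from [a], the only point of [K] in [A], so they lie in [N]. *)
apply: (trapK modN Kb Kc bc).
  by have [/(AK _ Kb)/esym|] := KU _ Kb.
by have [/(AK _ Kc)/esym|] := KU _ Kc.
Qed.

End Trapped.
End ModuleOperations.

(** The trace of [M] on the subgroup is a module with two distinct points, hence everything. *)
Lemma prime_subgroup_trapped d (G : ogroupType d) (K : groupClosed G) :
  prime_poset (subgroup_type K) -> trapped [set` K].
Proof.
move=> K_prime M x y modM /= Kx Ky xy Mx My z /= Kz.
pose x' : subgroup_type K := exist _ x Kx.
pose y' : subgroup_type K := exist _ y Ky.
pose z' : subgroup_type K := exist _ z Kz.
set M' := [set u : subgroup_type K | M (val u)].
have M'x : M' x' by [].
have M'y : M' y' by [].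
have [|e|[t e]|e] := K_prime M'.
- by move=> u m m'; exact: modM.
- by rewrite e in M'x.
- rewrite e in M'x M'y.
  by case: xy; rewrite -[x]/(val x') -[y]/(val y') M'x M'y.
- by have : M' z' by rewrite e.
Qed.

Lemma card_ge3_avoid T (A : set T) (x : T) : (`I_3 #<= A)%card ->
  exists y z, [/\ A y, A z, x <> y, x <> z & y <> z].
Proof.
move=> /card_leP[f].
pose g i (i3 : (i < 3)%N) : T := val (f (SigSub (mem_set i3 : i \in `I_3))).
have Ag i (i3 : (i < 3)%N) : A (g i i3) by exact: set_valP.
have neq i j (i3 : (i < 3)%N) (j3 : (j < 3)%N) : i <> j -> g i i3 <> g j j3.
  move=> ij /val_inj /(@inj _ _ _ f) e; apply: ij.
  by have [] := e (in_setT _) (in_setT _).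
have [e0|n0] := pselect (x = g 0%N isT).
  by exists (g 1%N isT), (g 2 isT); rewrite e0; split; try exact: Ag; exact: neq.
have [e1|n1] := pselect (x = g 1%N isT).
  by exists (g 0%N isT), (g 2 isT); rewrite e1; split; try exact: Ag; exact: neq.
by exists (g 0%N isT), (g 1%N isT); split; try exact: Ag; try exact: neq.
Qed.

(** * The module [hminus H] and comparison of cosets *)

Section Hminus.
Context d (G : ogroupType d).
Implicit Types (H L M : set G) (x y z : G).
Local Open Scope order_scope.

Lemma valuation_module H : valuation G H -> is_module H.
Proof. by case=> g _ <-; case: (strong_smod 1 g). Qed.

(** The sets in the union, the singleton of [1] among them, are modules sharing the point [1]. *)
Lemma hminus_module H : is_module (hminus H).
Proof.
set F := [set L | valuation G L /\ L `<` H].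
have -> : hminus H = \bigcup_(L in [set 1] |` F) L by rewrite bigcup_setU1.
apply: (@is_module_bigcup _ _ _ 1) => L [->|[VL _]] //.
- by move=> x m m' _ -> ->.
- exact: valuation_module.
- exact: val1g.
Qed.

(** After translation by [y^-1]: the point [y^-1 * x], outside the module [hminus H], does not
    separate its points [n] and [1]. Hence distinct cosets compare as their representatives do. *)
Lemma hminus_le_mulr H x y n : hminus H n -> ~ hminus H (y^-1 * x) ->
  (x <= y * n) = (x <= y).
Proof.
move=> Hn nyx; rewrite -(le_mul2g y^-1 1 x (y * n)) -(le_mul2g y^-1 1 x y).
rewrite !mulg1 mulKg mulVg.
have [e _] := hminus_module nyx Hn (hminus1 H).
by apply/idP/idP => /e.
Qed.

(** For [x] in [M] other than [1], [smod 1 x] lies in [M], so it is one of the sets whose union is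
    [hminus (smod 1 g)]. *)
Lemma strong_sub_hminus g M : strong_module M -> M 1 -> M `<` smod 1 g ->
  M `<=` hminus (smod 1 g).
Proof.
move=> sM M1 [MS nSM] x Mx.
have [->|x1] := pselect (x = 1); first exact: hminus1.
have xM : smod 1 x `<=` M by exact: smod_least.
right; exists (smod 1 x); last exact: smodr.
split; first by exists x.
split; first exact: subset_trans xM MS.
by move=> /subset_trans/(_ xM).
Qed.

End Hminus.

(** [M] is pulled back along the map sending [x] to the coset of [h * x], where [h] represents a
    member of [M]. The preimage is a module containing [1]; if it lies in [hminus (val H)], then [M]
    is a single coset. *)
Lemma prime_quot d (G : ogroupType d) (H : valuation G) :
  (forall M : set G, is_module M -> M 1 -> M `<=` val H ->
    M `<=` hminus (val H) \/ M = val H) ->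
  prime_poset (quot H).
Proof.
move=> hH M modM; have VH : valuation G (val H) := set_mem (valP H).
have [->|/eqP/set0P[A MA]] := pselect (M = set0); first exact: Or31.
have [h [Hh eA]] := Defs.quotP A.
have Hmul x : val H x -> val H (h * x) by exact: valMg.
have shift x : hminus (val H) x <-> hminus (val H) ((h * 1)^-1 * (h * x)).
  by rewrite mulg1 mulKg.
pose M' := [set x | exists Hx : val H x, M (coset_of (Hmul x Hx))].
have M'1 : M' 1.
  exists (val1g VH); have <- // : A = coset_of (Hmul 1 (val1g VH)).
  by rewrite eA; apply: eq_coset_of; rewrite mulg1.
have leE x y (Hx : val H x) (Hy : val H y) :
    coset_of (Hmul x Hx) <> coset_of (Hmul y Hy) ->
    (x <= y)%O <-> (coset_of (Hmul x Hx) <= coset_of (Hmul y Hy))%O.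
  move=> nxy; split=> [xy|/quot_leP[n Nn]].
    apply/quot_leP; exists 1; first exact: hminus1.
    by move: xy => /(le_mulg2 h 1); rewrite !mulg1.
  rewrite (hminus_le_mulr Nn) //.
    by move=> /(le_mulg2 h^-1 1); rewrite !mulg1 !mulKg.
  by move=> /(coset_of_eq (Hmul y Hy) (Hmul x Hx))/esym.
have modM' : is_module M'.
  move=> x m m' nx [Hm Mm] [Hm' Mm'].
  have [Hx|nHx] := pselect (val H x); last exact: (valuation_module VH).
  have nMx : ~ M (coset_of (Hmul x Hx)) by move=> Mx; apply: nx; exists Hx.
  have neq y (Hy : val H y) : M (coset_of (Hmul y Hy)) ->
      coset_of (Hmul x Hx) <> coset_of (Hmul y Hy) by move=> My e; rewrite e in nMx.
  have [e1 e2] := modM _ _ _ nMx Mm Mm'.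
  split.
    exact: iff_trans (leE _ _ _ _ (neq _ _ Mm))
      (iff_trans e1 (iff_sym (leE _ _ _ _ (neq _ _ Mm')))).
  exact: iff_trans (leE _ _ _ _ (nesym (neq _ _ Mm)))
    (iff_trans e2 (iff_sym (leE _ _ _ _ (nesym (neq _ _ Mm'))))).
have cosetE B : exists x (Hx : val H x), B = coset_of (Hmul x Hx).
  have [k [Hk ->]] := Defs.quotP B.
  exists (h^-1 * k), (valMg VH (valVg VH Hh) Hk).
  by apply: eq_coset_of; rewrite mulVKg.
have M'H : M' `<=` val H by move=> x [].
have [M'N|M'E] := hH _ modM' M'1 M'H.
  apply: Or32; exists A; apply/seteqP; split=> [B|B -> //].
  have [x [Hx ->]] := cosetE B => MB.
  apply/esym; rewrite /= eA; apply/coset_of_eq; rewrite mulKg.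
  by apply: M'N; exists Hx.
apply: Or33; apply/seteqP; split=> // B _.
have [x [Hx ->]] := cosetE B.
have [Hx' Mx] : M' x by rewrite M'E.
by rewrite (eq_coset_of (Hmul x Hx) (Hmul x Hx')).
Qed.

(** * Choice of [H], primality of its quotient, embedding and uniqueness *)

Theorem corollary5p2 (d : Order.disp_t) (G : ogroupType d) (K : groupClosed G)
    (K_prime : prime_poset (subgroup_type K))
    (K_ge3 : (`I_3 #<= [set` K])%card) :
  exists H : valuation G,
    [/\ unique (fun H : valuation G =>
          exists KH : [set` K] `<=` val H,
            [set` K] `&` hminus (val H) = [set 1] /\
            ogroup_embedding (nat_map KH)) H,
        prime_poset (quot H) &
        forall k : G, k \in K -> k != 1 -> smod 1 k = val H].
Proof.
have trapK := prime_subgroup_trapped K_prime.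
have K1 : [set` K] 1 by exact: gpred1.
have [b [c [Kb Kc n1b n1c nbc]]] := card_ge3_avoid 1 K_ge3.
have VS : smod 1 b \in valuation G by apply/mem_set; exists b => //= /esym.
pose H : valuation G := exist _ (smod 1 b) VS.
have KH : [set` K] `<=` val H := trapped_sub_smod trapK K1 Kb n1b.
have SH k : k \in K -> k != 1 -> smod 1 k = val H.
  move=> Kk /eqP/nesym k1; apply/seteqP; split.
    by apply: smod_sub; [exact: smodl|exact: KH].
  apply: smod_sub; first exact: smodl.
  exact: (trapped_sub_smod trapK K1 Kk k1).
have KHm : [set` K] `&` hminus (val H) = [set 1].
  (* A set [L] of the valuation containing some [k != 1] of [K] contains [smod 1 k], which is
     [H]. *)
  apply/seteqP; split=> [k [Kk]|_ ->]; last by split=> //; exact: hminus1.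
  case=> // -[L [VL [LH nHL]] Lk]; apply: contrapT => /eqP k1; apply: nHL.
  rewrite -(SH k) //; case: VL Lk => g _ <- gk.
  by apply: smod_sub => //; exact: smodl.
exists H; split=> //; last first.
  apply: prime_quot => M modM M1 MH.
  have [KM|nKM] := pselect ([set` K] `<=` M).
    right; apply/seteqP; split=> //.
    exact: (smod_trapped_sub trapK K1 Kb Kc).
  left; set A := \bigcup_(N in [set N | [/\ is_module N, N 1 & ~ [set` K] `<=` N]]) N.
  have MA : M `<=` A by move=> x Mx; exists M.
  apply: subset_trans MA _; apply: strong_sub_hminus.
  - exact: (strong_bigcup_avoiding trapK K1 Kb Kc).
  - by exists M.
  have nAb : ~ A b.
    by move=> [N [modN N1 nKN] Nb]; apply: nKN; exact: (trapK _ 1 b).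
  split; last by move=> h; apply/nAb/h; exact: smodr.
  (* [N] meets the strong module [H] in [1], and cannot contain it without containing [K]. *)
  move=> x [N [modN N1 nKN] Nx]; have [_ _ sS] := strong_smod 1 b.
  have [e|h|h] := sS _ modN; first 2 last.
  - by case: nKN; exact: subset_trans h.
  - by have : (set0 : set G) 1 by rewrite -e; split=> //; exact: smodl.
  - exact: h.
split.
  exists KH; split=> //.
  have Kdiv (x y : subgroup_type K) :
      hminus (val H) ((val x)^-1 * val y) -> x = y.
    move=> h; apply/val_inj.
    have : ([set` K] `&` hminus (val H)) ((val x)^-1 * val y).
      by split=> //=; rewrite gpredM ?gpredV //; exact: valP.
    by rewrite KHm => /= e; rewrite -[val y](mulVKg (val x)) e mulg1.
  split.
  - by move=> x y /coset_of_eq; exact: Kdiv.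
  - move=> x y; rewrite [RHS]quot_mulE; exact: eq_coset_of.
  - move=> x y; apply/idP/idP => [/quot_leP[n Nn]|xy]; last first.
      by apply/quot_leP; exists 1; [exact: hminus1|rewrite mulg1].
    have [->|xy] := eqVneq x y; first by rewrite Order.POrderTheory.lexx.
    by rewrite (hminus_le_mulr Nn) // => /Kdiv/esym/eqP; rewrite (negPf xy).
move=> H' [KH' [KHm' _]]; apply/val_inj/seteqP.
have VH' : valuation G (val H') := set_mem (valP H').
have HH' : val H `<=` val H'.
  case: VH' KH' => g _ <- KH'.
  by apply: smod_sub; [exact: smodl|exact: KH'].
split=> //; apply: contrapT => nH'H; apply: n1b.
(* If [H] were strictly inside [H'], it would be one of the sets forming [hminus (val H')], which
   would then contain [b]. *)
have : ([set` K] `&` hminus (val H')) b.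
  split=> //; right; exists (val H); last exact: smodr.
  by split; [exact: set_mem VS|split].
by rewrite KHm' => /= ->.
Qed.
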